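(* Let $d \ge 2$ be an integer. If $G$ is $Lad_d$ or $Lad_{d^+}$ (graphs of diameter $d$), then $rc(G) = src(G) = d$.
   Context: Graphs are finite, simple and connected. An outerplanar graph is a planar graph with a plane embedding in which all vertices lie on the boundary of the exterior face. A maximal outerplanar graph (MOP) is an outerplanar graph to which no edge can be added without losing outerplanarity; equivalently, a MOP is a graph obtained from $K_3$, embedded in the plane, by finitely many steps each joining a new vertex to two adjacent vertices along an edge of the exterior face. A minimum maximal outerplanar graph (MMOP) with diameter $d$ is a MOP of diameter $d$ having the minimum number of vertices among all MOPs of diameter $d$. $Lad_d$ denotes an MMOP with diameter $d$. It has a unique pair of vertices $a,f$ at distance $d$; the vertex $f$ has degree $2$ and its two neighbours are adjacent. $Lad_{d^+}$ is the graph obtained from $Lad_d$ by adding one new vertex $g$ adjacent to exactly two vertices: $f$, and a neighbour $e$ of $f$ that has degree $3$ in $Lad_d$. (For example, on vertices $1,\dots,2d$ one such $Lad_d$ has $i$ adjacent to $j$ exactly when $1\le |i-j|\le 2$, and the corresponding $Lad_{d^+}$ adds a vertex $2d+1$ adjacent to $2d-1$ and $2d$.) An edge coloring may give adjacent edges the same color. A path is a rainbow path if its edges have pairwise different colors. The rainbow connection number $rc(G)$ is the smallest number of colors in an edge coloring of $G$ such that every two vertices are joined by a rainbow path. The strong rainbow connection number $src(G)$ is the smallest number of colors in an edge coloring of $G$ such that every two vertices $u,v$ are joined by a rainbow path of length $d_G(u,v)$. *)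

(* Defs.v *)
From HB Require Import structures.
From mathcomp Require Import all_boot.

Set Implicit Arguments.
Unset Strict Implicit.
Unset Printing Implicit Defensive.

Record sgraph := SGraph {
  svertex :> finType;
  edge : rel svertex;
  edge_sym : symmetric edge;
  edge_irrefl : irreflexive edge }.

Arguments edge {s} x y : rename.

Definition isomorphic (G H : sgraph) : Prop :=
  exists2 phi : G -> H, bijective phi & forall x y, edge (phi x) (phi y) = edge x y.

Definition degree (G : sgraph) (x : G) : nat := #|[set y | edge x y]|.

(** As in [path], a path from [x] is given by its start [x] and the sequence [p]
    of its further vertices, so that [size p] is its length. *)
Definition is_path (G : sgraph) (x y : G) (p : seq G) : bool :=
  [&& path edge x p, last x p == y & uniq (x :: p)].

(** Least length of a path from [x] to [y]; the value is [#|G|] when there is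
    no such path (a path has length less than [#|G|]). *)
Definition dist (G : sgraph) (x y : G) : nat :=
  find (fun n => [exists p : n.-tuple G, is_path x y p]) (iota 0 #|G|).

Definition diam (G : sgraph) : nat := \max_(x : G) \max_(y : G) dist x y.

Definition K3_edge : rel 'I_3 := fun x y => x != y.

Lemma K3_sym : symmetric K3_edge.
Proof. by move=> x y; rewrite /K3_edge eq_sym. Qed.

Lemma K3_irrefl : irreflexive K3_edge.
Proof. by move=> x; rewrite /K3_edge eqxx. Qed.

Definition K3 : sgraph := SGraph K3_sym K3_irrefl.

(** [add_vertex x y] is [G] with a new vertex [None] adjacent exactly to [x]
    and [y]. *)
Definition add_vertex_edge (G : sgraph) (x y : G) : rel (option G) :=
  fun u v => match u, v with
  | Some a, Some b => edge a b
  | Some a, None | None, Some a => (a == x) || (a == y)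
  | None, None => false
  end.

Lemma add_vertex_sym (G : sgraph) (x y : G) : symmetric (add_vertex_edge x y).
Proof. by move=> [u|] [v|] //=; rewrite edge_sym. Qed.

Lemma add_vertex_irrefl (G : sgraph) (x y : G) :
  irreflexive (add_vertex_edge x y).
Proof. by move=> [u|] //=; rewrite edge_irrefl. Qed.

Definition add_vertex (G : sgraph) (x y : G) : sgraph :=
  SGraph (add_vertex_sym x y) (add_vertex_irrefl x y).

(** If the new vertex is drawn in the exterior face, along the exterior edge
    [xy], then [xy] becomes an interior edge and the two new edges are
    exterior; the other edges keep their status. *)
Definition add_vertex_ext (G : sgraph) (ext : rel G) (x y : G) :
    rel (add_vertex x y) :=
  fun u v => match u, v with
  | Some a, Some b => ext a b && ([set a; b] != [set x; y])
  | Some a, None | None, Some a => (a == x) || (a == y)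
  | None, None => false
  end.

(** [mop_ext ext]: the graph has an embedding built from a plane [K3] by adding
    vertices along exterior edges, and [ext] is the relation "joined by an edge
    of the exterior face" of that embedding. *)
Inductive mop_ext : forall G : sgraph, rel G -> Prop :=
| mop_K3 : mop_ext (@edge K3)
| mop_add (G : sgraph) (ext : rel G) (x y : G) :
    mop_ext ext -> ext x y -> mop_ext (@add_vertex_ext G ext x y).

Definition is_mop (G : sgraph) : Prop :=
  exists (H : sgraph) (ext : rel H), mop_ext ext /\ isomorphic G H.

Definition is_mmop (d : nat) (G : sgraph) : Prop :=
  [/\ is_mop G, diam G = d
    & forall H : sgraph, is_mop H -> diam H = d -> #|G| <= #|H|].

(** For [d >= 4] there are several non-isomorphic graphs [Lad_d]. *)
Definition is_Lad : nat -> sgraph -> Prop := is_mmop.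

(** The end [f] may be either vertex of the pair at distance [d], and [e] any
    neighbour of [f] of degree 3 (for [d = 2] both neighbours qualify). *)
Definition is_Lad_plus (d : nat) (G : sgraph) : Prop :=
  exists (L : sgraph) (a f e : L),
    [/\ is_Lad d L, dist a f = d, edge f e, degree e = 3
      & isomorphic G (add_vertex f e)].

(** A colouring is a function on vertex sets of which only the values on the
    edges [[set x; y]] matter; the colours are [0, ..., k-1]. *)
Definition edge_coloring (G : sgraph) (k : nat) (c : {set G} -> nat) : Prop :=
  forall x y : G, edge x y -> c [set x; y] < k.

Definition rainbow (G : sgraph) (c : {set G} -> nat) (x : G) (p : seq G) : bool :=
  uniq (pairmap (fun u v => c [set u; v]) x p).

Definition rainbow_connected (G : sgraph) (c : {set G} -> nat) : Prop :=
  forall x y : G, exists2 p : seq G, is_path x y p & rainbow c x p.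

Definition strongly_rainbow_connected (G : sgraph) (c : {set G} -> nat) : Prop :=
  forall x y : G,
    exists p : seq G, [/\ is_path x y p, rainbow c x p & size p = dist x y].

Definition is_least (P : nat -> Prop) (k : nat) : Prop :=
  P k /\ forall m, P m -> k <= m.

Definition is_rc (G : sgraph) : nat -> Prop :=
  is_least (fun k => exists2 c : {set G} -> nat,
    edge_coloring k c & rainbow_connected c).

Definition is_src (G : sgraph) : nat -> Prop :=
  is_least (fun k => exists2 c : {set G} -> nat,
    edge_coloring k c & strongly_rainbow_connected c).

(* Main.v *)
Require Import Defs.
From mathcomp Require Import all_boot.
From mathcomp Require Import zify.

(** Let [a] and [f] be at distance [d] in an MMOP. Since a MOP is 2-connected,
    every distance level from [a] strictly between [a] and [f] has at least two
    vertices; as some MOP of diameter [d] has only [2 d] vertices, these levels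
    have exactly two vertices and the last level is [f] alone. A two-vertex level
    separates [a] from [f], so it is a clique because MOPs are chordal. Hence all
    levels are cliques, and this persists in [Lad_{d^+}], where the last level is
    [f, g].

    Colour an edge by the larger of the levels of its ends. From a vertex go down
    to the level of a target: if the target has not been reached, it is one edge
    further inside that level, and the colour of this edge has not been used
    yet. *)

Set Implicit Arguments.
Unset Strict Implicit.
Unset Printing Implicit Defensive.

(** * Walks, distances and shortest paths *)

Section Distance.
Variable G : sgraph.
Implicit Types (x y z : G) (p : seq G).

(** A walk shortens to a path with fewer than [#|G|] edges, hence within the range that [dist]
    searches. *)
Lemma dist_walk x p : path edge x p -> dist x (last x p) <= size p.
Proof.
case/shortenP=> p' walk_p' uniq_p' sub_p'.
have size_p' : size p' <= size p.
  by apply: uniq_leq_size => //; case/andP: uniq_p'.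
have lt_p' : size p' < #|G|.
  by have := max_card [in x :: p']; rewrite (card_uniqP uniq_p').
apply: leq_trans size_p'; rewrite leqNgt; apply/negP => lt_dist.
have := before_find 0 lt_dist; rewrite nth_iota // add0n => /existsP[].
by exists (in_tuple p'); rewrite /is_path walk_p' eqxx uniq_p'.
Qed.

Lemma dist_attained x y :
  connect edge x y -> exists2 p, is_path x y p & size p = dist x y.
Proof.
case/connectP=> q /shortenP[p walk_p uniq_p _] ->.
have lt_p : size p < #|G|.
  by have := max_card [in x :: p]; rewrite (card_uniqP uniq_p).
have has_p : has (fun n => [exists t : n.-tuple G, is_path x (last x p) t])
    (iota 0 #|G|).
  apply/hasP; exists (size p); first by rewrite mem_iota.
  by apply/existsP; exists (in_tuple p); rewrite /is_path walk_p eqxx uniq_p.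
have := nth_find 0 has_p; rewrite has_find size_iota in has_p.
rewrite nth_iota // add0n => /existsP[t path_t].
by exists t => //; rewrite size_tuple.
Qed.

Lemma dist_refl x : dist x x = 0.
Proof. by apply/eqP; have := @dist_walk x [::] isT; rewrite leqn0. Qed.

Lemma dist_le_diam x y : dist x y <= diam G.
Proof.
have le_y := leq_bigmax_cond (F := fun z => dist x z) y isT.
have := leq_bigmax_cond (F := fun x => \max_z dist x z) x isT.
exact: leq_trans.
Qed.

Lemma diam_attained : 0 < diam G -> exists x y, dist x y = diam G.
Proof.
move=> diam_gt0; have G_gt0 : 0 < #|G|.
  rewrite lt0n; apply: contraL diam_gt0 => /eqP/card0_eq G0.
  by rewrite /diam big1 // => x; have := G0 x.
have [x diam_x] := eq_bigmax (fun x : G => \max_y dist x y) G_gt0.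
by have [y dist_y] := eq_bigmax (dist x) G_gt0; exists x, y; rewrite /diam diam_x.
Qed.

Lemma diam_le n : (forall x y, dist x y <= n) -> diam G <= n.
Proof. by move=> le_n; apply/bigmax_leqP => x _; apply/bigmax_leqP. Qed.

Lemma walk_rev x p : path edge x p -> path edge (last x p) (rev (belast x p)).
Proof. by rewrite rev_path; under eq_path do rewrite edge_sym. Qed.

Lemma last_rev_belast x p : last (last x p) (rev (belast x p)) = x.
Proof. by case: p => //= y p; rewrite rev_cons last_rcons. Qed.

Lemma connect_edge_sym : connect_sym (@edge G).
Proof. exact/sym_connect_sym/edge_sym. Qed.

Lemma dist_sym_le x y : connect edge x y -> dist y x <= dist x y.
Proof.
case/dist_attained=> p /and3P[walk_p /eqP <- _] <-.
have := dist_walk (walk_rev walk_p).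
by rewrite last_rev_belast size_rev size_belast.
Qed.

Lemma dist_sym x y : connect edge x y -> dist x y = dist y x.
Proof.
move=> xy; apply/eqP; rewrite eqn_leq !dist_sym_le //.
by rewrite connect_edge_sym.
Qed.

(** Removing the repetitions of [p] cannot make it shorter than the distance, so there was none to
    remove. *)
Lemma geodesic_is_path x p :
  path edge x p -> size p <= dist x (last x p) -> is_path x (last x p) p.
Proof.
move=> walk_p short_p; rewrite /is_path walk_p eqxx.
case/shortenP: (walk_p) short_p => p' walk_p' uniq_p' sub_p' short_p.
apply: (leq_size_uniq uniq_p') => [z|].
  by rewrite !inE => /orP[->//|/sub_p'->]; rewrite orbT.
by rewrite /= ltnS (leq_trans short_p) // dist_walk.
Qed.

Lemma is_path_rev x y p : is_path x y p -> is_path y x (rev (belast x p)).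
Proof.
case/and3P=> walk_p /eqP <- uniq_p; rewrite /is_path walk_rev //.
by rewrite last_rev_belast eqxx -rev_rcons -lastI rev_uniq.
Qed.

Lemma rainbow_rev (c : {set G} -> nat) x p :
  rainbow c (last x p) (rev (belast x p)) = rainbow c x p.
Proof.
rewrite /rainbow -rev_uniq; congr uniq.
elim: p x => //= y p IH x; rewrite rev_cons -cats1 pairmap_cat rev_cat /=.
by rewrite IH last_rev_belast setUC.
Qed.

Lemma lipschitz_walk (l : G -> nat) x p :
    (forall x y, edge x y -> l x <= (l y).+1) ->
  path edge x p -> l x <= size p + l (last x p).
Proof.
move=> lip; elim: p x => //= y p IH x /andP[xy /IH]; have := lip _ _ xy; lia.
Qed.

End Distance.

(** * Rainbow colouring of a graph whose levels are cliques *)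

(** The first three conditions force [l] to be the distance from [a]. Being local, they extend to a
    new vertex and pass through isomorphisms without recomputing distances. *)
Record clique_layering (G : sgraph) (a : G) (d : nat) (l : G -> nat) : Prop :=
  CliqueLayering {
    layer_root : l a = 0;
    layer_parent : forall x, x != a -> exists2 z, edge x z & l x = (l z).+1;
    layer_lipschitz : forall x y, edge x y -> l x <= (l y).+1;
    layer_clique : forall x y, l x = l y -> x != y -> edge x y;
    layer_bound : forall x, l x <= d }.

Section CliqueLayering.
Variables (G : sgraph) (a : G) (d : nat) (l : G -> nat).
Hypothesis lG : clique_layering a d l.
Implicit Types (x y z : G) (p : seq G).

(* The colour of [xy] is [max (l x) (l y) - 1]: it is the level of the lower
   end for an edge between two levels. *)
Definition layer_coloring (S : {set G}) : nat := (\max_(z in S) l z).-1.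

Lemma layer_coloringE x y : layer_coloring [set x; y] = (maxn (l x) (l y)).-1.
Proof.
rewrite /layer_coloring; have [<-|xy] := eqVneq x y.
  by rewrite setUid big_set1 maxnn.
by rewrite big_setU1 ?inE //= big_set1.
Qed.

Lemma layer_gt0 x : x != a -> 0 < l x.
Proof. by case/(layer_parent lG)=> z _ ->. Qed.

(** An edge has an end other than [a], so the larger level lies between 1 and [d], and its
    predecessor is below [d]. *)
Lemma layer_coloring_bound : edge_coloring d layer_coloring.
Proof.
move=> x y xy; rewrite layer_coloringE.
have := layer_bound lG x; have := layer_bound lG y.
have [xa|/layer_gt0] := eqVneq x a; last by lia.
have [ya|/layer_gt0] := eqVneq y a; last by lia.
by rewrite xa ya edge_irrefl in xy.
Qed.

Lemma descending_walk x k : k <= l x ->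
  exists p, [/\ path edge x p, l (last x p) = k & size p + k = l x].
Proof.
elim: {x}_.+1 {-2}x (ltnSn (l x)) => // n IH x lt_x le_k.
have [lx|lx] := eqVneq k (l x); first by exists [::].
have xa : x != a by apply: contraTneq le_k => xa; move: lx; rewrite xa (layer_root lG); lia.
have [z xz lz] := layer_parent lG xa.
have [||p [walk_p last_p size_p]] := IH z; try lia.
by exists (z :: p); rewrite /= xz; split => //; lia.
Qed.

(** Levels drop by at most one per edge, so the length bound makes every edge drop exactly one
    level. Its colour is then the level of its lower end, and these strictly decrease. *)
Lemma descending_colors x p :
    path edge x p -> size p + l (last x p) <= l x ->
  let s := pairmap (fun u v => layer_coloring [set u; v]) x p in
  uniq s /\ all (fun k => l (last x p) <= k < l x) s.
Proof.
elim: p x => //= y p IH x /andP[xy walk_p] short_p.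
have le_xy := layer_lipschitz lG xy.
have le_y := lipschitz_walk (layer_lipschitz lG) walk_p.
have ly : l x = (l y).+1 by lia.
have [|uniq_s /allP all_s] := IH _ walk_p; first lia.
rewrite layer_coloringE ly (maxn_idPl (leqnSn _)) /= uniq_s andbT ltnSn andbT.
split; first by apply/negP => /all_s; lia.
apply/andP; split; first lia.
by apply/allP => k /all_s; lia.
Qed.

Lemma layer_geodesic x y : l y <= l x ->
  exists p, [/\ is_path x y p, rainbow layer_coloring x p & size p = dist x y].
Proof.
move=> le_yx; have [p [walk_p last_p size_p]] := descending_walk le_yx.
(* Either a shortest path is no longer than the drop in level, and then it descends at every edge,
   or a descent to the level of [y] followed by one edge is already shortest. *)
have [dist_le|dist_gt] := leqP (dist x y + l y) (l x).
  have xy : connect edge x y.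
    have xz : connect edge x (last x p) by apply/connectP; exists p.
    have [<- //|zy] := eqVneq (last x p) y.
    exact/(connect_trans xz)/connect1/(layer_clique lG).
  have [q path_q size_q] := dist_attained xy; exists q; split => //.
  case/and3P: path_q => walk_q /eqP last_q _.
  by have [|] := descending_colors walk_q; rewrite ?last_q ?size_q.
have zy : last x p != y.
  apply: contraTneq dist_gt => zy; have := dist_walk walk_p; rewrite zy; lia.
have edge_zy := layer_clique lG last_p zy.
have walk_q : path edge x (rcons p y) by rewrite rcons_path walk_p.
have := dist_walk walk_q; have := geodesic_is_path walk_q.
rewrite last_rcons size_rcons => is_path_q dist_q.
exists (rcons p y); split; [apply: is_path_q; lia | | rewrite size_rcons; lia].
(* The final edge has colour [(l y).-1], whereas the descent uses only colours from [l y] on. *)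
rewrite /rainbow -cats1 pairmap_cat cats1 /= rcons_uniq layer_coloringE.
rewrite last_p maxnn.
have [|-> /allP all_s] := descending_colors walk_p; first by lia.
rewrite andbT; apply/negP => /all_s; rewrite last_p.
(* At level 0 the truncated predecessor could repeat colour 0. But [a] is alone on that level, and
   [last x p] and [y] are distinct vertices of one level. *)
have : 0 < l y; last by lia.
have [ya|/layer_gt0//] := eqVneq y a.
rewrite -last_p layer_gt0 //; apply: contra_neq zy => za.
by rewrite za ya.
Qed.

Lemma layer_strongly_rainbow : strongly_rainbow_connected layer_coloring.
Proof.
move=> x y; have [/layer_geodesic//|/ltnW/layer_geodesic] := leqP (l y) (l x).
case=> p [path_p rainbow_p size_p]; exists (rev (belast y p)).
have xy : connect edge y x.
  by case/and3P: path_p => walk_p /eqP <- _; apply/connectP; exists p.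
rewrite is_path_rev // size_rev size_belast size_p dist_sym //.
by case/and3P: path_p => _ /eqP <- _; rewrite rainbow_rev.
Qed.

(** A path from level [d] to level 0 has at least [d] edges, and a rainbow one gives them different
    colours below [k]. *)
Lemma rainbow_connected_bound f k (c : {set G} -> nat) :
  l f = d -> edge_coloring k c -> rainbow_connected c -> d <= k.
Proof.
move=> lf col_c rc_c; have [p /and3P[walk_p /eqP last_p _]] := rc_c f a.
have := lipschitz_walk (layer_lipschitz lG) walk_p.
rewrite last_p lf (layer_root lG) addn0 => d_le uniq_c.
have sub_c : {subset pairmap (fun u v => c [set u; v]) f p <= iota 0 k}.
  move: walk_p; elim: (p) f {lf last_p uniq_c} => //= y q IH x /andP[xy walk_q] i.
  by case/predU1P=> [->|/(IH _ walk_q)//]; rewrite mem_iota col_c.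
by have := uniq_leq_size uniq_c sub_c; rewrite size_pairmap size_iota; lia.
Qed.

Lemma clique_layering_rc f : l f = d -> is_rc G d /\ is_src G d.
Proof.
move=> lf; split; split.
- exists layer_coloring; first exact: layer_coloring_bound.
  by move=> x y; have [p [? ? _]] := layer_strongly_rainbow x y; exists p.
- by move=> k [c]; apply: rainbow_connected_bound lf.
- exists layer_coloring; first exact: layer_coloring_bound.
  exact: layer_strongly_rainbow.
- move=> k [c col_c src_c]; apply: (rainbow_connected_bound lf col_c) => x y.
  by have [p [? ? _]] := src_c x y; exists p.
Qed.

End CliqueLayering.

(** * Connections inside a vertex set, 2-connectedness and chordality *)

(** An edge may be sent to a whole connection or to a single point, which covers retractions and
    collapses as well as embeddings. *)
Lemma connect_image (T T' : finType) (e : rel T) (e' : rel T') (r : T -> T') :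
    (forall x y, e x y -> connect e' (r x) (r y)) ->
  forall x y, connect e x y -> connect e' (r x) (r y).
Proof.
move=> er x _ /connectP[p walk_p ->]; elim: p x walk_p => //= y p IH x.
by case/andP=> /er xy /IH; apply: connect_trans.
Qed.

Section Linked.
Variable G : sgraph.
Implicit Types (P Q : pred G) (x y z u v : G).

(** Connection in the subgraph induced by [P]; by reflexivity of [connect], a vertex outside [P] is
    still linked to itself. *)
Definition linked P : rel G := connect [rel x y | [&& edge x y, P x & P y]].

Lemma linked1 P x y : P x -> P y -> edge x y -> linked P x y.
Proof. by move=> Px Py xy; apply: connect1; rewrite /= xy Px. Qed.

Lemma linked_sym P : connect_sym [rel x y : G | [&& edge x y, P x & P y]].
Proof.
by apply: sym_connect_sym => x y /=; rewrite edge_sym; case: (P x); case: (P y).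
Qed.

Lemma linked_connect P x y : linked P x y -> connect edge x y.
Proof. by apply: connect_sub => s t /and3P[st _ _]; apply: connect1. Qed.

Lemma linked_neighbor P x y :
  linked P x y -> x != y -> exists2 z, edge x z & P z.
Proof.
case/connectP=> [[|z p] /= walk_p ->]; first by rewrite eqxx.
by case/andP: walk_p => /and3P[xz _ Pz] _ _; exists z.
Qed.

(** A discrete intermediate value theorem: a walk cannot jump over a level on its way up. *)
Lemma linked_level P (l : G -> nat) k x y :
    (forall x y, edge x y -> l x <= (l y).+1) ->
  linked P x y -> P x -> l x <= k <= l y -> exists2 z, P z & l z = k.
Proof.
move=> lip /connectP[p + ->]; elim: p x => [|z p IH] x /= => [_|].
  by move=> Px lk; exists x => //; lia.
case/andP=> /and3P[xz _ Pz] walk_p Px lk.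
have [lx|lx] := eqVneq (l x) k; first by exists x.
by apply: (IH z) => //; have := lip z x; rewrite edge_sym xz => /(_ isT); lia.
Qed.

(* 2-connectedness, and connectedness for [P = predT]. *)
Definition robust := forall P, (forall x y, ~~ P x -> ~~ P y -> x = y) ->
  forall x y, P x -> P y -> linked P x y.

(* Dirac's property of chordal graphs: two vertices with connections through
   two sides not touching each other are adjacent. *)
Definition clique_separators := forall u v P Q,
  linked P u v -> linked Q u v ->
  (forall s t, P s -> Q t -> s \notin [:: u; v] -> t \notin [:: u; v] ->
    (s != t) && ~~ edge s t) ->
  u != v -> edge u v.

Lemma robust_connect : robust -> forall x y, connect edge x y.
Proof. by move=> rG x y; apply/(@linked_connect predT)/rG. Qed.

End Linked.

(** * Transport along isomorphisms *)

Section Isomorphism.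
Variables (G H : sgraph) (phi : G -> H).
Hypothesis phiE : forall x y, edge (phi x) (phi y) = edge x y.

Lemma robust_iso : bijective phi -> robust H -> robust G.
Proof.
case=> psi phiK psiK rH P P1 x y Px Py.
rewrite -[x]phiK -[y]phiK; apply: (connect_image (e := _)) (rH (P \o psi) _ _ _ _ _).
- move=> s t /and3P[st Ps Pt]; apply: linked1 => //.
  by rewrite -phiE !psiK.
- by move=> s t Ps Pt; rewrite -[s]psiK -[t]psiK; congr phi; apply: P1.
- by rewrite /= phiK.
- by rewrite /= phiK.
Qed.

Lemma clique_separators_iso :
  bijective phi -> clique_separators H -> clique_separators G.
Proof.
case=> psi phiK psiK cH u v P Q Puv Quv sepPQ uv.
have img R : linked R u v -> linked (R \o psi) (phi u) (phi v).
  apply: connect_image => s t /and3P[st Rs Rt].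
  by apply: linked1; rewrite ?phiE //= phiK.
rewrite -phiE; apply: cH (img _ Puv) (img _ Quv) _ _.
  move=> s t Ps Qt; rewrite -[s]psiK -[t]psiK.
  have in_map z : (phi z \in [:: phi u; phi v]) = (z \in [:: u; v]).
    by rewrite !inE !(can_eq phiK).
  by rewrite !in_map phiE (can_eq phiK) /= => ??; apply: sepPQ.
by rewrite (can_eq phiK).
Qed.

Lemma clique_layering_iso a d l :
  injective phi -> (forall y, exists x, phi x = y) ->
  clique_layering (phi a) d l -> clique_layering a d (l \o phi).
Proof.
move=> phi_inj phi_surj [root parent lip clique bound].
split=> //= [x xa|x y|x y lxy xy].
- have [|z xz lz] := parent (phi x); first by rewrite (inj_eq phi_inj).
  by have [z' z'E] := phi_surj z; exists z'; rewrite -?phiE z'E.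
- by rewrite -phiE; apply: lip.
- by rewrite -phiE; apply: clique => //; rewrite (inj_eq phi_inj).
Qed.

End Isomorphism.

(** * Adding a vertex along an edge *)

Section AddVertex.
Variables (G : sgraph) (x y : G).
Hypothesis xy : edge x y.
Local Notation H := (add_vertex x y).

Lemma linked_Some (P : pred H) u v :
  linked (P \o Some) u v -> linked P (Some u) (Some v).
Proof.
by apply: connect_image => s t /and3P[st Ps Pt]; apply: linked1.
Qed.

(* The new vertex is retracted onto one of its two adjacent neighbours. *)
Lemma linked_retract (P : pred H) u v :
  linked P (Some u) (Some v) -> linked (P \o Some) u v.
Proof.
pose r (w : H) := if w is Some w' then w' else if P (Some x) then x else y.
apply: (@connect_image _ _ _ _ r) => -[s|] [t|] /and3P[//= st Ps Pt].
- exact: linked1.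
- case: ifP => Px; case/orP: st => /eqP sE; subst s; rewrite ?connect0 //.
  + by apply: linked1; rewrite //= 1?edge_sym.
  + by rewrite Ps in Px.
- case: ifP => Px; case/orP: st => /eqP tE; subst t; rewrite ?connect0 //.
  + exact: linked1.
  + by rewrite Pt in Px.
Qed.

(** At most one vertex is missing from [P], so [x] or [y] remains to attach the new vertex to the
    old ones. *)
Lemma add_vertex_robust : robust G -> robust H.
Proof.
move=> rG P P1.
have old u v : P (Some u) -> P (Some v) -> linked P (Some u) (Some v).
  move=> Pu Pv; apply/linked_Some/rG => // s t Ps Pt.
  by apply: Some_inj; apply: P1.
have new v : P None -> P (Some v) -> linked P None (Some v).
  move=> PN Pv; have [Px|Px] := boolP (P (Some x)).
    by apply: connect_trans (old x v Px Pv); apply: linked1; rewrite //= eqxx.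
  have Py : P (Some y).
    by apply: contraTT xy => Py; rewrite [y](Some_inj (P1 _ _ Py Px)) edge_irrefl.
  by apply: connect_trans (old y v Py Pv); apply: linked1; rewrite //= eqxx orbT.
move=> [u|] [v|] Pu Pv; [exact: old | | exact: new | exact: connect0].
by rewrite /linked linked_sym; apply: new.
Qed.

(** Connections between old vertices retract to [G]. Those from the new vertex start through [x] or
    [y]; if neither first step is [v], these steps are equal or adjacent, so the two sides touch. *)
Lemma add_vertex_clique_separators : clique_separators G -> clique_separators H.
Proof.
move=> cG.
have new (v : H) (P Q : pred H) : linked P None v -> linked Q None v ->
    (forall s t : H, P s -> Q t -> s \notin [:: None; v] ->
       t \notin [:: None; v] -> (s != t) && ~~ edge s t) ->
    None != v -> @edge H None v.
  move=> PNv QNv sepPQ Nv.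
  have [[s|] Ns Ps //] := linked_neighbor PNv Nv.
  have [[t|] Nt Qt //] := linked_neighbor QNv Nv.
  have [<- //|sv] := eqVneq (Some s) v.
  have [<- //|tv] := eqVneq (Some t) v.
  have := sepPQ _ _ Ps Qt; rewrite !inE (negPf sv) (negPf tv).
  move=> /(_ isT isT)/andP[/= st]; move: Ns Nt st => /=.
  by do 2!case/orP=> /eqP->; rewrite ?eqxx ?xy 1?edge_sym ?xy.
move=> [u|] [v|] P Q Puv Quv sepPQ uv //; try exact: new Puv Quv sepPQ uv.
  apply: cG (linked_retract Puv) (linked_retract Quv) _ uv => s t Ps Qt.
  by move=> suv tuv; have := sepPQ _ _ Ps Qt; rewrite !inE in suv tuv *; apply.
rewrite edge_sym; apply: new => //.
- by rewrite /linked linked_sym; apply: Puv.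
- by rewrite /linked linked_sym; apply: Quv.
- move=> s t Ps Qt sE tE.
  by apply: sepPQ => //; [move: sE | move: tE]; rewrite !inE orbC.
Qed.

(** The new vertex joins [x], so far alone on level [d], and [y], one level below, is its parent. *)
Lemma add_vertex_layering a d l :
    clique_layering a d l -> l x = d -> l y < d ->
    (forall z, l z = d -> z = x) ->
  @clique_layering H (Some a) d (fun w => if w is Some z then l z else d).
Proof.
move=> lG lx ly l_max.
have ly_eq : d = (l y).+1 by have := layer_lipschitz lG xy; lia.
split.
- exact: (layer_root lG).
- move=> [z|] za; last by exists (Some y); rewrite //= eqxx orbT.
  by have [w zw lw] := layer_parent lG (x := z) za; exists (Some w).
- move=> [s|] [t|] //=; first exact: (layer_lipschitz lG).
    by move=> _; have := layer_bound lG s; lia.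
  by case/orP=> /eqP->; lia.
- move=> [s|] [t|] //=; first exact: (layer_clique lG).
    by move=> /l_max-> _; rewrite eqxx.
  by move=> /esym/l_max-> _; rewrite eqxx.
- by move=> [z|] //; apply: (layer_bound lG).
Qed.

Lemma dist_Some (u v : G) : connect edge u v -> @dist H (Some u) (Some v) <= dist u v.
Proof.
case/dist_attained=> p /and3P[walk_p /eqP <- _] <-.
rewrite -last_map -(size_map some) dist_walk //.
by rewrite path_map.
Qed.

End AddVertex.

Lemma dist_cons (G : sgraph) (x y z : G) :
  connect edge y z -> edge x y -> dist x z <= (dist y z).+1.
Proof.
case/dist_attained=> p /and3P[walk_p /eqP <- _] <- xy.
by apply: (@dist_walk _ x (y :: p)); rewrite /= xy.
Qed.

(** * MOPs are 2-connected and chordal *)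

Lemma mop_ext_edge (G : sgraph) (ext : rel G) :
  mop_ext ext -> subrel ext edge.
Proof.
elim=> {G ext} [//|G ext x y _ IH xy] [u|] [v|] //= /andP[uv _].
exact: IH.
Qed.

Lemma mop_ext_robust (G : sgraph) (ext : rel G) : mop_ext ext -> robust G.
Proof.
elim=> {G ext} [P _ x y Px Py|G ext x y mG rG xy].
  by have [->|xy] := eqVneq x y; [apply: connect0 | apply: linked1].
exact: add_vertex_robust (mop_ext_edge mG xy) rG.
Qed.

Lemma mop_ext_clique_separators (G : sgraph) (ext : rel G) :
  mop_ext ext -> clique_separators G.
Proof.
elim=> {G ext} [//|G ext x y mG cG xy].
exact: add_vertex_clique_separators (mop_ext_edge mG xy) cG.
Qed.

Lemma mop_robust (G : sgraph) : is_mop G -> robust G.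
Proof.
by case=> H [ext [mH [phi phi_bij phiE]]]; apply: robust_iso (mop_ext_robust mH).
Qed.

Lemma mop_clique_separators (G : sgraph) : is_mop G -> clique_separators G.
Proof.
case=> H [ext [mH [phi phi_bij phiE]]].
exact: clique_separators_iso (mop_ext_clique_separators mH).
Qed.


(** * A MOP of diameter [d] with [2 d] vertices *)

(** A triangulated strip that can be prolonged at the exterior edge [xy]. The function [l] certifies
    that [x] and [y] are at distance at least [k.+1] from [a]. *)
Record ladder (k : nat) (G : sgraph) (ext : rel G) (a x y : G)
    (l : G -> nat) : Prop := Ladder {
  ladder_mop : mop_ext ext;
  ladder_ext : ext x y;
  ladder_card : #|G| = k.*2 + 3;
  ladder_dist : forall u v : G, dist u v <= k.+1;
  ladder_lip : forall u v : G, edge u v -> l u <= (l v).+1;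
  ladder_root : l a = 0;
  ladder_left : l x = k.+1;
  ladder_right : l y = k.+1 }.

Lemma add_vertex_dist (G : sgraph) (x y : G) n :
    edge x y -> (forall u v : G, connect edge u v) ->
    (forall u v : G, dist u v <= n) ->
  forall u v : add_vertex x y, dist u v <= n.+1.
Proof.
move=> xy cG dG; set H := add_vertex x y.
have step : @edge H None (Some x) by rewrite /= eqxx.
have cH : forall u v : G, @connect H edge (Some u) (Some v).
  by move=> u v; apply: connect_image (cG u v) => s t st; apply: connect1.
have new v : @dist H None (Some v) <= n.+1.
  apply: leq_trans (dist_cons (cH x v) step) _.
  by rewrite ltnS (leq_trans (dist_Some x y (cG _ _))).
move=> [u|] [v|]; last by rewrite dist_refl.
- by rewrite (leq_trans (dist_Some x y (cG _ _))) // leqW.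
- rewrite dist_sym //.
  by rewrite connect_edge_sym; apply: connect_trans (connect1 step) (cH _ _).
- exact: new.
Qed.

Lemma ladder_exists k : exists G ext a x y l, @ladder k G ext a x y l.
Proof.
elim: k => [|k [G [ext [a [x [y [l [mG xy cardG distG lipG la lx ly]]]]]]]].
  (* The triangle: [a] on level 0, the other two vertices on level 1, with booleans read as
     numbers. *)
  exists K3, (@edge K3), ord0, (inord 1), (inord 2).
  exists (fun i => i != ord0 :> 'I_3).
  split; rewrite ?card_ord //; first exact: mop_K3.
  - by apply/eqP => /(congr1 val); rewrite /= !inordK.
  - move=> u v; have [<-|uv] := eqVneq u v; first by rewrite dist_refl.
    by apply: (@dist_walk K3 u [:: v]); rewrite /= andbT.
  - by move=> u v _; case: eqP; case: eqP.
  - by rewrite -val_eqE /= inordK.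
  - by rewrite -val_eqE /= inordK.
have exy := mop_ext_edge mG xy.
(* Each round adds one vertex over [xy] and another over the edge from it to [y]; these two form the
   next exterior edge, one level higher. *)
pose G1 := add_vertex x y.
have mG1 : mop_ext (@add_vertex_ext G ext x y) by apply: mop_add.
have ext1 : @add_vertex_ext G ext x y None (Some y) by rewrite /= eqxx orbT.
have e1 := mop_ext_edge mG1 ext1.
have cG := robust_connect (mop_ext_robust mG).
have cG1 := robust_connect (mop_ext_robust mG1).
have distG1 := add_vertex_dist exy cG distG.
pose G2 := @add_vertex G1 None (Some y).
have mG2 : mop_ext (@add_vertex_ext G1 (@add_vertex_ext G ext x y) None (Some y)).
  exact: mop_add.
have cG2 := robust_connect (mop_ext_robust mG2).
exists G2, (@add_vertex_ext G1 (@add_vertex_ext G ext x y) None (Some y)).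
exists (Some (Some a)), None, (Some None).
exists (fun w => if w is Some (Some u) then l u else k.+2).
split=> //.
- by rewrite !card_option cardG; lia.
(* Using [add_vertex_dist] twice would lose one. The second new vertex is adjacent to [y], so it
   reaches the old vertices in one extra step. *)
- have new v : @dist G2 None v <= k.+2.
    case: v => [[v|]|]; last by rewrite dist_refl.
      apply: (@leq_trans (@dist G2 (Some (Some y)) (Some (Some v))).+1).
        by apply: dist_cons => //=; rewrite eqxx orbT.
      rewrite ltnS (leq_trans (@dist_Some G1 None (Some y) _ _ (cG1 _ _))) //.
      by rewrite (leq_trans (dist_Some x y (cG _ _))).
    by apply: leq_trans (@dist_walk G2 None [:: Some None] isT) _.
  move=> [u|] [v|]; try exact: new.
    by rewrite (leq_trans (@dist_Some G1 None (Some y) _ _ (cG1 _ _))).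
  by rewrite dist_sym.
- have lip1 : forall u : G, (u == x) || (u == y) -> l u = k.+1.
    by move=> u /orP[]/eqP->.
  move=> [[u|]|] [[v|]|] //=; try exact: lipG.
  + by move/lip1; lia.
  + by move/eqP=> [->]; lia.
  + by move/lip1; lia.
  + by move/eqP=> [->]; lia.
Qed.

Lemma small_mop d : 2 <= d -> exists H, [/\ is_mop H, diam H = d & #|H| = d.*2].
Proof.
case: d => [|[|k]] // _; have [G [ext [a [x [y [l]]]]]] := ladder_exists k.
case=> mG xy cardG distG lipG la lx ly; have exy := mop_ext_edge mG xy.
have mH : mop_ext (@add_vertex_ext G ext x y) by apply: mop_add.
have cG := robust_connect (mop_ext_robust mG).
have cH := robust_connect (mop_ext_robust mH).
exists (add_vertex x y); split; last by rewrite card_option cardG; lia.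
  exists (add_vertex x y), (@add_vertex_ext G ext x y); split=> //.
  by exists id => //; exists id.
apply/eqP; rewrite eqn_leq diam_le /=; last exact: add_vertex_dist.
apply: leq_trans (dist_le_diam (None : add_vertex x y) (Some a)).
have [p /and3P[walk_p /eqP last_p _] <-] := dist_attained (cH None (Some a)).
(* A single vertex over [xy] lies one level above it, hence at distance at least [k.+2] from [a]. *)
pose lH (w : add_vertex x y) := if w is Some u then l u else k.+2.
have lipH u v : @edge (add_vertex x y) u v -> lH u <= (lH v).+1.
  case: u v => [u|] [v|] //=; first exact: lipG.
    by case/orP=> /eqP->; rewrite ?lx ?ly; lia.
  by case/orP=> /eqP->; rewrite ?lx ?ly.
by have := lipschitz_walk lipH walk_p; rewrite last_p /= la addn0.
Qed.

(** * The distance levels of an MMOP *)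

Section MMOP.
Variables (G : sgraph) (d : nat) (a f : G).
Hypotheses (d_ge2 : 2 <= d) (mmopG : is_mmop d G) (dist_af : dist a f = d).
Local Notation l := (dist a).
Implicit Types (x y z u v w : G).

Let mopG : is_mop G. Proof. by case: mmopG. Qed.

Lemma mmop_connect x y : connect edge x y.
Proof. exact/robust_connect/mop_robust. Qed.

Lemma mmop_lipschitz x y : edge x y -> l x <= (l y).+1.
Proof.
have ca z := @dist_sym _ _ _ (mmop_connect a z).
by move=> xy; rewrite !ca; apply: dist_cons => //; apply: mmop_connect.
Qed.

Lemma mmop_parent x : x != a -> exists2 z, edge x z & l x = (l z).+1.
Proof.
move=> xa; have [p /and3P[walk_p /eqP last_p _] size_p] := dist_attained (mmop_connect a x).
case/lastP: p => [|p z] in walk_p last_p size_p; first by rewrite -last_p eqxx in xa.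
rewrite last_rcons in last_p; subst z; rewrite rcons_path size_rcons in walk_p size_p.
case/andP: walk_p => walk_p zx; exists (last a p); first by rewrite edge_sym.
have := dist_walk walk_p; have := @mmop_lipschitz x (last a p).
by rewrite edge_sym zx => /(_ isT); lia.
Qed.

Lemma mmop_dist_le x : l x <= d.
Proof. by case: mmopG => _ <- _; apply: dist_le_diam. Qed.

Lemma mmop_card : #|G| <= d.*2.
Proof.
case: mmopG => _ _ minG; have [H [mH diamH <-]] := small_mop d_ge2.
exact: minG.
Qed.

(** A walk from [a] to [f] meets level [k] in some [w]; after deleting [w] another walk remains, and
    it meets the level elsewhere. *)
Lemma mmop_layer_ge2 k : 0 < k < d -> 1 < #|[set x | l x == k]|.
Proof.
move=> k_bd; have lk : l a <= k <= l f by rewrite dist_refl dist_af; lia.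
have rG := mop_robust mopG.
have [|w _ lw] := linked_level mmop_lipschitz (rG predT _ a f isT isT) isT lk.
  by [].
have aw : a != w by apply: contraTneq k_bd => aw; rewrite -lw -aw dist_refl.
have fw : f != w.
  by apply: contraTneq k_bd => fw; rewrite -lw -fw dist_af ltnn andbF.
have [|w' w'w lw'] := linked_level mmop_lipschitz (rG (predC1 w) _ a f aw fw) aw lk.
  by move=> x y /negPn/eqP-> /negPn/eqP->.
have <- : #|[set w; w']| = 2 by rewrite cards2 eq_sym (w'w : w' != w).
by apply/subset_leq_card/subsetP => x /set2P[]->; rewrite inE ?lw ?lw'.
Qed.

(* Every level strictly between [a] and [f] has at least two vertices, and
   there are only [2 d] vertices. *)
Lemma mmop_layer_card k : k <= d ->
  #|[set x | l x == k]| = if (k == 0) || (k == d) then 1 else 2.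
Proof.
pose N (i : 'I_d.+1) := #|[set x | l x == i]|.
pose M (i : 'I_d.+1) := if (i == 0 :> nat) || (i == d :> nat) then 1 else 2.
have leMN i : M i <= N i.
  rewrite /M; have [i0|i0] /= := eqVneq (i : nat) 0.
    by apply/card_gt0P; exists a; rewrite inE dist_refl i0.
  have [id|id] := eqVneq (i : nat) d.
    by apply/card_gt0P; exists f; rewrite inE dist_af id.
  by apply: mmop_layer_ge2; have := ltn_ord i; lia.
have sumN : \sum_i N i = #|G|.
  rewrite -sum1_card (partition_big (fun x => inord (l x) : 'I_d.+1) predT) //=.
  apply: eq_bigr => i _; rewrite /N -sum1dep_card; apply: eq_bigl => x.
  by rewrite -val_eqE /= inordK // ltnS mmop_dist_le.
have sumM : \sum_i M i = d.*2.
  rewrite /M; case: (d) d_ge2 => [//|n] _.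
  rewrite big_ord_recl big_ord_recr /= eqxx.
  rewrite (eq_bigr (fun=> 2)) ?sum_nat_const ?card_ord; first by lia.
  by move=> i _; case: eqP => //; have := ltn_ord i; rewrite /bump; lia.
(* Equality of the sums will force equality of all terms. *)
have leq_MN : \sum_i M i <= \sum_i N i ?= iff [forall i, M i == N i].
  by apply: leqif_sum => i _; split.
move=> k_le; have : \sum_i M i == \sum_i N i.
  by rewrite eqn_leq leq_MN sumN sumM mmop_card.
by rewrite leq_MN => /forallP/(_ (Ordinal (k_le : k < d.+1)))/eqP/esym.
Qed.

Lemma mmop_last x : l x = d -> x = f.
Proof.
move=> lx; have /eqP/cards1P[z layer] : #|[set x | l x == d]| = 1.
  by rewrite mmop_layer_card // eqxx orbT.
have in_layer y : l y = d -> y = z.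
  by move=> ly; apply/set1P; rewrite -layer inE ly.
by rewrite [x]in_layer // [f]in_layer.
Qed.

(** Going from [u] to [a] along parents, all vertices after [u] lie strictly below its level. *)
Lemma linked_below (P : pred G) u :
  (forall z, l z < l u -> P z) -> P u -> linked P a u.
Proof.
move=> below Pu.
have down n z : l z <= n -> P z -> l z <= l u -> linked P a z.
  elim: n z => [|n IH] z lzn Pz lzu; have [->|] := eqVneq z a.
  - exact: connect0.
  - by case/mmop_parent=> z' _; lia.
  - exact: connect0.
  - case/mmop_parent=> z' zz' lz; have Pz' : P z' by apply: below; lia.
    apply: connect_trans (IH z' _ Pz' _) _; try lia.
    by apply: linked1; rewrite // edge_sym.
exact: (down (l u)).
Qed.

(* Since [v] does not separate [a] from [f], collapsing everything up to the
   level of [u] and [v] onto [u] leaves a connection above that level. *)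
Lemma linked_above (Q : pred G) u v :
    0 < l v < d -> l u = l v -> (forall w, l w = l v -> w != v -> w = u) ->
  (forall z, l u < l z -> Q z) -> Q u -> linked Q u f.
Proof.
move=> lv_bd luv layer above Qu.
pose r z := if l z <= l u then u else z.
have av : a != v by apply: contraTneq lv_bd => <-; rewrite dist_refl.
have fv : f != v by apply: contraTneq lv_bd => <-; rewrite dist_af ltnn andbF.
have : linked (predC1 v) a f.
  by apply: (mop_robust mopG) => // x y /negPn/eqP-> /negPn/eqP->.
move/(connect_image (e' := [rel x y | [&& edge x y, Q x & Q y]]) (r := r)).
have -> : r a = u by rewrite /r dist_refl.
have -> : r f = f by rewrite /r dist_af leqNgt luv; case/andP: lv_bd => _ ->.
apply => s t /and3P[st /= sv tv]; rewrite /r.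
(* An edge leaving the collapsed part upwards starts on the level of [u], and there only [u] is
   left. *)
have cross s' t' : edge s' t' -> s' != v -> l s' <= l u -> l u < l t' ->
    linked Q u t'.
  move=> st' s'v ls lt; have := mmop_lipschitz (y := s') (x := t').
  rewrite edge_sym st' => /(_ isT) lt'.
  have s'u : s' = u by apply: layer => //; lia.
  by apply: linked1; rewrite -?s'u // ?s'u //; apply: above.
case: (leqP (l s) (l u)) => ls; case: (leqP (l t) (l u)) => lt.
- exact: connect0.
- exact: cross st sv ls lt.
- by rewrite linked_sym; apply: (cross t); rewrite // edge_sym.
- by apply: linked1 => //; apply: above.
Qed.

Lemma mmop_layer_clique x y : l x = l y -> x != y -> edge x y.
Proof.
move=> lxy xy.
(* Levels 0 and [d] are singletons, so two distinct vertices of one level lie strictly between. *)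
have lx_gt0 : 0 < l x.
  rewrite lt0n; apply: contra_neq xy => lx0.
  have root z : l z = 0 -> z = a.
    by move=> lz; have [//|/mmop_parent[z' _]] := eqVneq z a; lia.
  by rewrite [x]root // [y]root // -lxy.
have lx_ltd : l x < d.
  rewrite ltn_neqAle mmop_dist_le andbT; apply: contra_neq xy => lxd.
  by rewrite [x]mmop_last // [y]mmop_last // -lxy.
have layer w : l w = l x -> (w == x) || (w == y).
  move=> lw; have : [set x; y] == [set z | l z == l x].
    rewrite eqEcard cards2 xy mmop_layer_card; last exact: ltnW.
    rewrite (gtn_eqF lx_gt0) (ltn_eqF lx_ltd) andbT.
    by apply/subsetP => z /set2P[]->; rewrite inE ?lxy.
  by move/eqP/setP/(_ w); rewrite !inE lw eqxx.
(* [x] and [y] are linked below through [a] and above through [f]. Apart from them, the levels of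
   the two sides differ by at least two, so the sides do not touch. *)
pose P := [pred z | (l z < l x) || (z \in [:: x; y])].
pose Q := [pred z | (l x < l z) || (z \in [:: x; y])].
have Pxy : linked P x y.
  apply: (@connect_trans _ _ a); first rewrite linked_sym.
    by apply: linked_below => [z|] /=; rewrite ?inE ?eqxx ?orbT // => ->.
  by apply: linked_below => [z|] /=; rewrite ?inE ?eqxx ?orbT // lxy => ->.
have Qxy : linked Q x y.
  apply: (@connect_trans _ _ f); last rewrite linked_sym.
    apply: (@linked_above _ _ y) => //=; rewrite -?lxy ?lx_gt0 //.
    - by move=> w /layer/orP[/eqP//|->].
    - by move=> z ->.
    - by rewrite inE eqxx orbT.
  apply: (@linked_above _ _ x) => //=; rewrite ?lx_gt0 //.
  - by move=> w /layer/orP[->//|/eqP].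
  - by move=> z; rewrite -lxy => ->.
  - by rewrite !inE eqxx !orbT.
apply: (mop_clique_separators mopG) Pxy Qxy _ xy => s t /=.
move=> /orP[ls|->//] /orP[lt|-> //] _ _; apply/andP; split.
  by apply: contraTneq ls => ->; lia.
by rewrite edge_sym; apply/negP => /mmop_lipschitz; lia.
Qed.

Lemma mmop_clique_layering : clique_layering a d l.
Proof.
split; [exact: dist_refl | exact: mmop_parent | exact: mmop_lipschitz | |].
  exact: mmop_layer_clique.
exact: mmop_dist_le.
Qed.

End MMOP.

Theorem theorem2p1 (d : nat) (G : sgraph) (hd : 2 <= d)
    (hG : is_Lad d G \/ is_Lad_plus d G) :
  is_rc G d /\ is_src G d.
Proof.
case: hG => [mmopG|[L [a [f [e [mmopL dist_af fe _ [phi phi_bij phiE]]]]]]].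
  have [a [f dist_af]] : exists a f : G, dist a f = d.
    by case: (mmopG) => _ diamG _; rewrite -diamG; apply: diam_attained; lia.
  exact: (clique_layering_rc (mmop_clique_layering hd mmopG dist_af) dist_af).
have l_max := mmop_last hd mmopL dist_af.
(* Only [f] is on level [d], and [e] is a neighbour of [f]. *)
have e_lt : dist a e < d.
  rewrite ltn_neqAle (mmop_dist_le a mmopL) andbT; apply: contraTneq fe => /l_max->.
  by rewrite edge_irrefl.
have lH := add_vertex_layering fe (mmop_clique_layering hd mmopL dist_af) dist_af
  e_lt l_max.
(* The layering is pulled back to [G]: its root is the preimage of [a], and the preimage of the new
   vertex lies on level [d]. *)
case: (phi_bij) => psi phiK psiK; rewrite -[Some a]psiK in lH.
have phi_surj y : exists x, phi x = y by exists (psi y).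
apply: (clique_layering_rc (clique_layering_iso phiE (can_inj phiK) phi_surj lH)
  (f := psi None)).
by rewrite /= psiK.
Qed.
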